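(* Let $\mu$ be a pure $k$-determinantal measure on $[k]^n$ with matrices $A_1,\dots,A_k$, and let $n_i=\operatorname{rank}(A_i)$, so $n_1+\dots+n_k=n$. Let $V_i\subset\mathbb{R}^n$ be the image of $A_i$, let $U_i=\{n_1+\dots+n_{i-1}+1,\dots,n_1+\dots+n_i\}\subset[n]$, let $M$ be an $n\times n$ matrix such that for each $i$ the columns of $M$ indexed by $U_i$ span $V_i$ (such $M$ is invertible), and let $L=M^{-1}$. Then for every $\pi\in[k]^n$ in which each color $i$ occurs exactly $n_i$ times, $$\Pr(\pi)=(-1)^{\pi}\,Q\prod_{i=1}^k L_{U_i}^{\pi(U_i)},$$ where $Q=\det M$, $\pi(U_i)\subset[n]$ is the set of positions at which the color $i$ occurs in $\pi$, $L_{U_i}^{\pi(U_i)}$ is the minor of $L$ with rows $U_i$ and columns $\pi(U_i)$, and $(-1)^\pi$ is the signature of $\pi$ thought of as a permutation of $[n]$.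
   Context: $[k]=\{1,\dots,k\}$ is the set of colors. A $k$-determinantal measure on $[k]^n$ with matrices $A_1,\dots,A_k$ is a probability measure on $[k]^n$, where the $A_i$ are real $n\times n$ matrices with $A_1+\dots+A_k=I$, and for all $(i_1,\dots,i_n)\in[k]^n$, $\Pr((i_1,\dots,i_n))=\det(A_{i_1}^1,A_{i_2}^2,\dots,A_{i_n}^n)$, the determinant of the matrix whose $j$th column is the $j$th column of $A_{i_j}$ (superscripts on matrices denote columns). It is pure if the sum of the ranks of the $A_i$ is exactly $n$. For a matrix $L$ and sets $R,C$ of the same size, $L_R^C$ denotes the determinant of the submatrix with rows $R$ and columns $C$, both taken in increasing order (an empty minor equals $1$). The sequence $\pi$ with $n_i$ occurrences of each color $i$ is regarded as the permutation of $[n]$ which, for each $i$, maps the $r$th smallest element of $U_i$ to the $r$th smallest element of $\pi(U_i)$. For example with $k=3$, $(n_1,n_2,n_3)=(2,2,2)$, the point $\pi=(2,1,1,3,2,3)$ corresponds to the permutation $123456\to 231546$, of signature $-1$. *)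

(* Defs.v *)
From HB Require Import structures.
From mathcomp Require Import all_boot all_order all_algebra all_fingroup.
From mathcomp Require Import reals.

Set Implicit Arguments.
Unset Strict Implicit.
Unset Printing Implicit Defensive.

Import Order.TTheory GRing.Theory Num.Theory.
Local Open Scope ring_scope.

(* Colors are 'I_k and positions 'I_n, both numbered from 0;
   a point of [k]^n is a w : {ffun 'I_n -> 'I_k}, and a measure on this finite
   set is given by its mass function. *)

Definition is_probability (R : realType) (T : finType) (mu : T -> R) : Prop :=
  (forall x, 0 <= mu x) /\ \sum_x mu x = 1.

Definition determinantal (R : realType) (k n : nat) (A : 'I_k -> 'M[R]_n)
    (mu : {ffun 'I_n -> 'I_k} -> R) : Prop :=
  [/\ is_probability mu,
      \sum_i A i = 1%:M
    & forall w, mu w = \det (\matrix_(r, j) A (w j) r j)].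

Definition pure (R : realType) (k n : nat) (A : 'I_k -> 'M[R]_n) : Prop :=
  (\sum_i \rank (A i))%N = n.

Definition block (k n : nat) (d : 'I_k -> nat) (i : 'I_k) : {set 'I_n} :=
  [set j : 'I_n | (\sum_(l < k | l < i) d l <= j < \sum_(l < k | l <= i) d l)%N].

Definition positions (k n : nat) (w : {ffun 'I_n -> 'I_k}) (i : 'I_k) :
  {set 'I_n} := [set j | w j == i].

(* [enum] lists a set of ordinals in increasing order.  The default value of
   [nth] is never used when #|S| = #|T|, the only case of interest. *)
Definition minor (R : realType) (n : nat) (L : 'M[R]_n) (S T : {set 'I_n}) : R :=
  \det (\matrix_(a < #|S|, b < #|S|)
          L (enum_val a) (nth (enum_val b) (enum T) b)).

(* The positions of color 0 in increasing order, then those of color 1, etc.: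
   the one-line notation of the permutation attached to w. *)
Definition word_seq (k n : nat) (w : {ffun 'I_n -> 'I_k}) : seq 'I_n :=
  flatten [seq enum (positions w i) | i <- enum 'I_k].

Lemma word_seq_uniq k n (w : {ffun 'I_n -> 'I_k}) : uniq (word_seq w).
Proof.
rewrite /word_seq; move: (enum_uniq 'I_k); elim: (enum 'I_k) => //= i s IHs.
case/andP=> i_s /IHs us; rewrite cat_uniq enum_uniq us andbT /=.
apply/hasPn => j /flattenP[t /mapP[l ls ->]].
rewrite !mem_enum !inE => /eqP wj; apply: contra i_s => /eqP <-.
by rewrite wj.
Qed.

Lemma word_seq_size k n (w : {ffun 'I_n -> 'I_k}) : size (word_seq w) = n.
Proof.
rewrite -[RHS]size_enum_ord; apply: perm_size; apply: uniq_perm.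
- exact: word_seq_uniq.
- exact: enum_uniq.
move=> j; rewrite mem_enum; apply/flattenP.
exists (enum (positions w (w j))); last by rewrite mem_enum inE.
by apply: map_f; rewrite mem_enum.
Qed.

Lemma word_fun_inj k n (w : {ffun 'I_n -> 'I_k}) :
  injective (fun j : 'I_n => nth j (word_seq w) j).
Proof.
move=> j1 j2 /eqP; rewrite (set_nth_default j1 j2) ?word_seq_size //.
rewrite nth_uniq ?word_seq_size //; last exact: word_seq_uniq.
by move/eqP/val_inj.
Qed.

Definition word_perm (k n : nat) (w : {ffun 'I_n -> 'I_k}) : {perm 'I_n} :=
  perm (@word_fun_inj k n w).

Section WordPermChar.
Variables (k n : nat) (w : {ffun 'I_n -> 'I_k}) (d : 'I_k -> nat).
Hypothesis card_w : forall i, #|positions w i| = d i.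
Variable i : 'I_k.

Let before := flatten [seq enum (positions w l) | l <- take i (enum 'I_k)].

Let size_before : size before = (\sum_(l < k | l < i) d l)%N.
Proof.
rewrite size_flatten sumnE /shape -map_comp big_map.
rewrite (eq_bigr d) => [|l _]; last by rewrite /= -cardE card_w.
rewrite [RHS]big_mkcond -[RHS]big_mkcond -[RHS]big_filter; apply: perm_big.
apply: uniq_perm; rewrite ?take_uniq ?filter_uniq ?enum_uniq ?index_enum_uniq //.
move=> l; rewrite mem_filter mem_index_enum andbT in_take ?mem_enum //.
by rewrite index_enum_ord.
Qed.

Let word_seq_split : exists after,
  word_seq w = before ++ enum (positions w i) ++ after.
Proof.
exists (flatten [seq enum (positions w l) | l <- drop i.+1 (enum 'I_k)]).
rewrite /word_seq -{1}(cat_take_drop i (enum 'I_k)) map_cat flatten_cat.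
by rewrite (drop_nth i) ?size_enum_ord // nth_ord_enum.
Qed.

Let sum_le : (\sum_(l < k | l <= i) d l = \sum_(l < k | l < i) d l + d i)%N.
Proof.
rewrite (bigD1 i) //= addnC; congr addn; apply: eq_bigl => l.
by rewrite [RHS]ltn_neqAle andbC.
Qed.

Let bound : (\sum_(l < k | l < i) d l + d i <= n)%N.
Proof.
have [t E] := word_seq_split; rewrite -[leqRHS](word_seq_size w) E !size_cat.
by rewrite size_before -cardE card_w addnA leq_addr.
Qed.

Let val_enum_block :
  map val (enum (block n d i)) = iota (\sum_(l < k | l < i) d l)%N (d i).
Proof.
apply: (irr_sorted_eq ltn_trans ltnn).
- have: sorted ltn (map val (enum 'I_n)) by rewrite val_enum_ord iota_ltn_sorted.
  rewrite !sorted_map [enum (block n d i)]/enum_mem -enumT.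
  by apply: sorted_filter => a b c; exact: ltn_trans.
- exact: iota_ltn_sorted.
move=> j; rewrite mem_iota; apply/mapP/idP.
  by case=> l; rewrite mem_enum inE sum_le => ? ->.
move=> hj; have jn : (j < n)%N by case/andP: hj => _ /leq_trans; apply.
by exists (Ordinal jn); rewrite // mem_enum inE sum_le.
Qed.

Lemma card_block : #|block n d i| = d i.
Proof. by rewrite cardE -(size_map val) val_enum_block size_iota. Qed.

(* [word_perm w] maps the r-th smallest element of the i-th block to the r-th
   smallest position of color i. *)
Lemma word_permE (x0 : 'I_n) (r : nat) : (r < d i)%N ->
  word_perm w (nth x0 (enum (block n d i)) r) = nth x0 (enum (positions w i)) r.
Proof.
move=> rd; set j := nth _ _ _.
have vj : val j = (\sum_(l < k | l < i) d l + r)%N.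
  rewrite /j -(nth_map x0 0%N val) -?cardE ?card_block //.
  by rewrite val_enum_block nth_iota.
rewrite permE (set_nth_default x0) ?word_seq_size // vj.
have [t ->] := word_seq_split.
by rewrite nth_cat size_before ltnNge leq_addr /= addKn nth_cat -cardE card_w rd.
Qed.

End WordPermChar.

(* Main.v *)
(** Since the columns of [M] in the [i]-th block [U_i] span the image of
    [A_i], we have [A_i = M D_i X_i], with [D_i] the diagonal projection on
    [U_i].  Summing over [i], [1 = M (\sum_i D_i X_i)], so [M] is invertible
    with inverse [L = \sum_i D_i X_i], and [A_i = M D_i L] as the blocks are
    disjoint.  Hence [Pr(w) = \det M * \det P], where [P] is obtained from [L]
    by zeroing the entries of column [j] outside the rows of [U_(w j)].
    Permuting the columns of [P] by the permutation of [w] gives a block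
    diagonal matrix whose diagonal blocks are those defining the minors
    [L_{U_i}^{w(U_i)}]. *)
Require Import Defs.
From HB Require Import structures.
From mathcomp Require Import all_boot all_order all_algebra all_fingroup.
From mathcomp Require Import reals.

Set Implicit Arguments.
Unset Strict Implicit.
Unset Printing Implicit Defensive.

Import Order.TTheory GRing.Theory Num.Theory.
Local Open Scope ring_scope.

Lemma det_castmx (R : comPzRingType) m n (e e' : m = n) (B : 'M[R]_m) :
  \det (castmx (e, e') B) = \det B.
Proof. by case: n / e e' => e'; rewrite [e']eq_irrelevance castmx_id. Qed.

Lemma det_mxdiag (R : comNzRingType) k (p : 'I_k -> nat)
    (B : forall i, 'M[R]_(p i)) :
  \det (\mxdiag_i B i) = \prod_i \det (B i).
Proof.
elim: k p B => [|k IHk] p B.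
  (* The size here is an empty sum, equal to [0] by a lemma rather than by computation, hence the
     generalization over [n]. *)
  have det0 n (C : 'M[R]_n) : n = 0%N -> \det C = 1.
    by move=> n0; subst n; exact: det_mx00.
  by rewrite [RHS]big_ord0 det0 // big_ord0.
by rewrite mxdiag_recl det_castmx det_ublock IHk big_ord_recl.
Qed.

(** Once [m] and [n] are identified, this is conjugation by a permutation matrix, whose sign occurs
    twice and cancels. *)
Lemma det_mxsub_bij (R : comPzRingType) m n (g : 'I_m -> 'I_n) (B : 'M[R]_n) :
  bijective g -> \det (mxsub g g B) = \det B.
Proof.
move=> bij_g; have := bij_eq_card bij_g; rewrite !card_ord => mn.
case: n / mn in g bij_g B *; pose s := perm (bij_inj bij_g).
have ->: mxsub g g B = perm_mx s *m (B *m (perm_mx s)^T).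
  rewrite tr_perm_mx -col_permE -row_permE.
  by apply/matrixP => r c; rewrite !mxE !permE.
by rewrite !det_mulmx det_tr det_perm mulrCA -signr_addb addbb mulr1.
Qed.

(** The classes [S i] of [f] need not be intervals. Listing them one after the other reindexes rows
    and columns by the same bijection and turns [B] into an [\mxdiag]. *)
Lemma det_block_diagonal (R : comNzRingType) k n (f : 'I_n -> 'I_k)
    (S : 'I_k -> {set 'I_n}) (B : 'M[R]_n) :
    (forall i r, (r \in S i) = (f r == i)) ->
    (forall r c, f r != f c -> B r c = 0) ->
  \det B = \prod_i \det (mxsub (@enum_val _ (mem (S i)))
                               (@enum_val _ (mem (S i))) B).
Proof.
move=> SE B0.
pose h (x : {i : 'I_k & 'I_#|S i|}) : 'I_n := enum_val (tagged x).
have fh x : f (h x) = tag x.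
  by apply/eqP; rewrite -SE; exact: enum_valP.
have S_f r : r \in S (f r) by rewrite SE.
pose h' r : {i : 'I_k & 'I_#|S i|} :=
  Tagged (fun i => 'I_#|S i|) (enum_rank_in (S_f r) r).
have h'K : cancel h' h by move=> r; rewrite /h /= enum_rankK_in.
have h_inj : injective h.
  move=> x y hxy; have := congr1 f hxy; rewrite !fh.
  case: x y hxy => i a [j b] /= hab ij; case: j / ij in b hab *.
  by congr (Tagged (fun i => 'I_#|S i|) _); apply: enum_val_inj.
have hK : cancel h h' by apply: inj_can_sym h'K h_inj.
have h_bij : bijective h by exists h'.
rewrite -(det_mxsub_bij B (bij_comp h_bij (@tagnat.sig_bij k _))) -det_mxdiag.
congr (\det _); apply/matrixP => r c; rewrite [LHS]mxE [RHS]mxE /=.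
rewrite (tagnat.sigE12 r) (tagnat.sigE12 c).
move: (tagnat.sig2 r) (tagnat.sig2 c).
(* Inside a diagonal block, eliminating the equality of the block indices removes the cast
   [conform_mx]; elsewhere [B0] applies. *)
case: eqVneq => [e|ne] a b.
  move: e b; move: (tagnat.sig1 c) => j e; case: j / e => b.
  by rewrite conform_mx_id mxE.
by rewrite mxE B0 // !fh.
Qed.

(** Each column of [A] is the image of a basis vector, so it has a preimage under [B]; these
    preimages are the columns of [X]. *)
Lemma limg_mulmxS (F : fieldType) m n p (A : 'M[F]_(m, n)) (B : 'M[F]_(m, p)) :
    (limg (linfun (mulmx A : 'cV[F]_n -> 'cV[F]_m)) <=
     limg (linfun (mulmx B : 'cV[F]_p -> 'cV[F]_m)))%VS ->
  exists X, A = B *m X.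
Proof.
move=> /subvP sAB.
have /fin_all_exists[x Ax] c : exists x : 'cV[F]_p, col c A = B *m x.
  have: col c A \in limg (linfun (mulmx A : 'cV[F]_n -> 'cV[F]_m)).
    by rewrite colE -[_ *m _]lfunE memv_img ?memvf.
  by move/sAB => /memv_imgP[x _ ->]; exists x; rewrite lfunE.
exists (\matrix_(r, c) x c r 0); apply/matrixP => r c.
have /colP/(_ r) := Ax c; rewrite !mxE => ->.
by apply: eq_bigr => l _; rewrite mxE.
Qed.

Definition proj_mx_set (R : pzRingType) n (S : {set 'I_n}) : 'M[R]_n :=
  diag_mx (\row_j (j \in S)%:R).

Lemma proj_mx_setE (R : pzRingType) n p (S : {set 'I_n}) (X : 'M[R]_(n, p)) r c :
  (proj_mx_set R S *m X) r c = (r \in S)%:R * X r c.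
Proof. by rewrite mul_diag_mx !mxE. Qed.

(** For [j] in [S] the projection fixes the basis vector [e_j], so [M] and [M *m proj_mx_set F S]
    both send it to [col j M]. *)
Lemma span_col_proj (F : fieldType) m n (M : 'M[F]_(m, n)) (S : {set 'I_n}) :
  (<<[seq col j M | j in S]>> <=
   limg (linfun (mulmx (M *m proj_mx_set F S) : 'cV[F]_n -> 'cV[F]_m)))%VS.
Proof.
apply/span_subvP => v /mapP[j]; rewrite mem_enum => jS ->.
have -> : col j M = linfun (mulmx (M *m proj_mx_set F S)) (delta_mx j (0 : 'I_1)).
  rewrite lfunE /= -mulmxA colE; congr (_ *m _); apply/matrixP => r c.
  rewrite proj_mx_setE [delta_mx _ _ _ _]mxE.
  by case: (eqVneq r j) => [->|_]; rewrite ?jS ?mul1r ?mulr0.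
by rewrite memv_img ?memvf.
Qed.

(** If [i < l], the sum bounding block [i] from above runs over some of the indices of the sum
    bounding block [l] from below. *)
Lemma block_inj k n (d : 'I_k -> nat) (i l : 'I_k) (r : 'I_n) :
  r \in block n d i -> r \in block n d l -> i = l.
Proof.
wlog il : i l / (i <= l)%N => [H|].
  case/orP: (leq_total i l) => [/H|/H] // H1 ri rl.
  by rewrite (H1 rl ri).
rewrite !inE => /andP[_ ri] /andP[rl _]; apply/val_inj/eqP.
rewrite eqn_leq il leqNgt; apply/negP => lt_il.
suff: (\sum_(j < k | j <= i) d j <= \sum_(j < k | j < l) d j)%N.
  by rewrite leqNgt (leq_ltn_trans rl ri).
rewrite big_mkcond [leqRHS]big_mkcond leq_sum // => j _.
by case: (leqP j i) => // /leq_ltn_trans ->.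
Qed.

Theorem theorem7 (R : realType) (k n : nat) (A : 'I_k -> 'M[R]_n)
    (mu : {ffun 'I_n -> 'I_k} -> R)
    (mu_det : determinantal A mu) (A_pure : pure A)
    (d : 'I_k -> nat) (d_rank : forall i, d i = \rank (A i))
    (M : 'M[R]_n)
    (M_span : forall i : 'I_k,
       <<[seq col j M | j in block n d i]>>%VS
         = limg (linfun (mulmx (A i) : 'cV[R]_n -> 'cV[R]_n))) :
  M \in unitmx /\
  forall w : {ffun 'I_n -> 'I_k},
    (forall i, #|positions w i| = d i) ->
    mu w = (-1) ^+ odd_perm (word_perm w) * \det M *
           \prod_(i < k) minor (invmx M) (block n d i) (positions w i).
Proof.
have [_ A_sum mu_w] := mu_det.
pose D i := proj_mx_set R (block n d i).
have /fin_all_exists[X AX] i : exists X, A i = M *m D i *m X.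
  by apply: limg_mulmxS; rewrite -M_span; exact: span_col_proj.
have ML : M *m (\sum_i D i *m X i) = 1%:M.
  by rewrite mulmx_sumr -A_sum; apply: eq_bigr => i _; rewrite AX mulmxA.
have [M_unit _] := mulmx1_unit ML; split=> // w card_w.
have defL : invmx M = \sum_i D i *m X i.
  by rewrite -[RHS](mulKmx M_unit) ML mulmx1.
have AL i : A i = M *m (D i *m invmx M).
  rewrite AX -mulmxA defL; congr (_ *m _); apply/matrixP => r c.
  rewrite !proj_mx_setE; case: (boolP (r \in _)) => [ri|_]; last by rewrite !mul0r.
  (* In a row [r] of block [i], every summand of [L] but the [i]-th vanishes. *)
  rewrite summxE (bigD1 i) //= proj_mx_setE ri !mul1r big1 ?addr0 // => l li.
  rewrite proj_mx_setE; case: (boolP (r \in _)) => [rl|_]; last by rewrite mul0r.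
  by rewrite (block_inj ri rl) eqxx in li.
set L := invmx M in AL *; set s := word_perm w.
pose P : 'M[R]_n := \matrix_(r, j) ((r \in block n d (w j))%:R * L r j).
have -> : mu w = \det M * \det P.
  rewrite mu_w -det_mulmx; congr (\det _); apply/matrixP => r j.
  rewrite mxE AL !mxE; apply: eq_bigr => l _.
  by rewrite proj_mx_setE [P _ _]mxE.
have -> : \det P = (-1) ^+ s * \det (col_perm s P).
  by rewrite col_permE det_mulmx det_perm odd_permV mulrCA -signr_addb addbb mulr1.
rewrite mulrA [\det M * _]mulrC; congr (_ * _).
(* [s] maps block [i] into the positions of color [i], and the two sets have the same
   cardinality. *)
have blockE i r : (r \in block n d i) = (w (s r) == i).
  have -> : block n d i = s @^-1: positions w i; last by rewrite !inE.
  apply/eqP; rewrite eqEcard card_preimset //; last exact: perm_inj.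
  rewrite (card_block card_w) card_w leqnn andbT; apply/subsetP => j ji.
  have jb : j \in enum (block n d i) by rewrite mem_enum.
  have jd : (index j (enum (block n d i)) < d i)%N.
    by rewrite -(card_block card_w i) cardE index_mem.
  rewrite inE -(nth_index j jb) (word_permE card_w) //.
  by rewrite -mem_enum mem_nth // -cardE card_w.
rewrite (det_block_diagonal (f := w \o s) blockE) => [|r c]; last first.
  by rewrite !mxE blockE /= => /negPf->; rewrite mul0r.
apply: eq_bigr => i _; congr (\det _); apply/matrixP => a b.
have bi := enum_valP b.
have bd : (b < d i)%N by rewrite -(card_block card_w i).
(* The [b]-th position of color [i] is the image under [s] of the [b]-th element of block [i]; by
   [bd] the default of [nth] is not reached. *)
rewrite !mxE -(word_permE card_w) // -(enum_val_nth _ b) -/s.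
move: bi (enum_valP a); rewrite blockE => /eqP-> ->.
by rewrite mul1r.
Qed.
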